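(* Let $\mathcal S\subseteq\{-1,0,1\}^d\setminus\{\mathbf 0\}$ be a set of unit steps in dimension $d$. Suppose $\mathcal S$ is symmetric with respect to each axis and, for each coordinate $k$, $\mathcal S$ contains a step whose $k$-th coordinate is $1$. Let $e_n$ be the number of walks of length $n$ taking steps in $\mathcal S$, beginning and ending at the origin, and never leaving the orthant $\mathbb{Z}_{\ge0}^d$. Then $$e_n=O\!\left(\frac{|\mathcal S|^n}{n^{3d/2}}\right).$$
   Context: Symmetric with respect to each axis means $(i_1,\dots,i_k,\dots,i_d)\in\mathcal{S}$ implies $(i_1,\dots,-i_k,\dots,i_d)\in\mathcal{S}$ for every $k$. *)

(* Defs.v *)
From HB Require Import structures.
From mathcomp Require Import all_boot all_order all_algebra.
From mathcomp Require Import finmap.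
From mathcomp Require Import all_classical all_reals all_analysis.

Set Implicit Arguments.
Unset Strict Implicit.
Unset Printing Implicit Defensive.

Import Order.TTheory GRing.Theory Num.Theory.
Import numFieldNormedType.Exports.

Local Open Scope ring_scope.

Section Walks.
Variables (d : nat) (S : {fset 'rV[int]_d}).

Definition unit_steps : Prop :=
  forall s, s \in S -> s != 0 /\ forall k : 'I_d, s 0 k \in [:: -1; 0; 1].

Definition reflect_axis (k : 'I_d) (s : 'rV[int]_d) : 'rV[int]_d :=
  \row_i (if i == k then - s 0 i else s 0 i).

Definition axis_symmetric : Prop :=
  forall s, s \in S -> forall k : 'I_d, reflect_axis k s \in S.

Definition forward_in_each_coordinate : Prop :=
  forall k : 'I_d, exists2 s, s \in S & s 0 k = 1.

Definition in_orthant (x : 'rV[int]_d) : bool := [forall k, 0 <= x 0 k].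

Definition walk_pos (w : seq S) (m : nat) : 'rV[int]_d :=
  \sum_(s <- take m w) val s.

Definition orthant_excursions (n : nat) : {set n.-tuple S} :=
  [set w : n.-tuple S |
    [forall m : 'I_n.+1, in_orthant (walk_pos w m)] && (walk_pos w n == 0)].

Definition num_excursions (n : nat) : nat := #|orthant_excursions n|.

End Walks.

(* Main.v *)
Require Import Defs.
From HB Require Import structures.
From mathcomp Require Import all_boot all_order all_algebra.
From mathcomp Require Import finmap.
From mathcomp Require Import all_classical all_reals all_analysis.
From mathcomp Require Import zify ring lra.

Set Implicit Arguments.
Unset Strict Implicit.
Unset Printing Implicit Defensive.

Import Order.TTheory GRing.Theory Num.Theory.
Import numFieldNormedType.Exports.

Local Open Scope classical_set_scope.
Local Open Scope ring_scope.

(** Flipping the signs of the coordinates of each step independently preserves the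
    set of walks, so [e_n] is the sum over all words [w] of [S^n] of the product over
    the coordinates [k] of the probability that a fair one-dimensional walk of length
    [m_k(w)] is a Dyck path, where [m_k(w)] counts the letters of [w] with nonzero
    [k]-th coordinate. This probability is a Catalan number over [2^m], hence
    [O((m+1)^(-3/2))]. Since a positive proportion of the letters moves each
    coordinate, the inverse moments of [m_k + 1] over words of length [n] are
    [O(|S|^n n^(-r))], and comparing the product over [k] with a sum of [d]-th powers
    gives the exponent [3d/2]. *)

(** * Ballot numbers and their decay *)

(* Walks on the naturals with [m] steps [+1] or [-1] from [x] to [0]. *)
Fixpoint ballot (m x : nat) : nat :=
  match m, x with
  | 0, 0 => 1
  | 0, _.+1 => 0
  | m'.+1, 0 => ballot m' 1
  | m'.+1, x'.+1 => ballot m' x'.+2 + ballot m' x'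
  end.

Lemma ballot_odd m x : odd (m + x) -> ballot m x = 0%N.
Proof.
elim: m x => [|m IH] [|x] //= h.
  by apply: IH; lia.
by rewrite !IH //; lia.
Qed.

Lemma ballot_lt m x : (m < x)%N -> ballot m x = 0%N.
Proof.
elim: m x => [|m IH] [|x] //= h.
by rewrite !IH //; lia.
Qed.

(** The ballot formula with its denominator cleared, where [j] counts the up steps. Strong induction
    on the length: the first step splits the count as in Pascal's rule. *)
Lemma ballot_bin j x :
  (ballot (j.*2 + x) x * (j + x).+1 = x.+1 * 'C(j.*2 + x, j))%N.
Proof.
have [m le_m] := ubnP (j.*2 + x)%N; elim: m j x le_m => // m IH [|j] [|x] le_m.
- by [].
- have IH0 := IH 0%N x ltac:(lia).
  rewrite /= add0n ballot_lt ?add0n; last by lia.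
  move/eqP: IH0; rewrite double0 !add0n !bin0 mulnC eqn_pmul2l // => /eqP ->.
  by rewrite muln1 mul1n.
- have := IH j 1%N ltac:(lia).
  rewrite doubleS addn0 /= addn1 addn0 => IH1.
  have B1 := mul_bin_left j.*2.+1 j.
  have B2 : ('C(j.*2.+2, j.+1) = 'C(j.*2.+1, j.+1) + 'C(j.*2.+1, j))%N by rewrite binS.
  have e : (j.*2.+1 - j = j.+1)%N by lia.
  rewrite e in B1; move/eqP: B1; rewrite eqn_pmul2l // => /eqP B1.
  by rewrite B2 B1 mul1n addnn -['C(_, _).*2]mul2n -IH1 addn1.
- have H1 := IH j x.+2 ltac:(lia); have H2 := IH j.+1 x ltac:(lia).
  have -> : (j.+1.*2 + x.+1 = (j.*2 + x).+3)%N by lia.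
  have e1 : (j.*2 + x.+2 = (j.*2 + x).+2)%N by lia.
  have e2 : (j.+1.*2 + x = (j.*2 + x).+2)%N by lia.
  have e3 : ((j + x.+2).+1 = (j + x).+3)%N by lia.
  have e4 : ((j.+1 + x).+1 = (j + x).+2)%N by lia.
  have -> : ((j.+1 + x.+1).+1 = (j + x).+3)%N by lia.
  rewrite e1 e3 in H1; rewrite e2 e4 in H2.
  rewrite [ballot _.+3 _]/(ballot (j.*2 + x).+2 x.+2 + ballot (j.*2 + x).+2 x)%N.
  have B1 := mul_bin_left (j.*2 + x).+2 j.
  have B2 : ('C((j.*2 + x).+3, j.+1) = 'C((j.*2 + x).+2, j.+1) + 'C((j.*2 + x).+2, j))%N
    by rewrite binS.
  have e : ((j.*2 + x).+2 - j = (j + x).+2)%N by lia.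
  rewrite e in B1; rewrite B2; move: H1 H2 B1; clear.
  move: (ballot _ x.+2) (ballot _ x) ('C(_, _)) ('C(_, _)) => u1 u2 v w H1 H2 B1.
  (* These factors clear the denominators in both induction hypotheses and in the ratio of the two
     neighbouring binomials [v] and [w]. *)
  apply/eqP; rewrite -(eqn_pmul2l (m := (j + x).+2)) //.
  rewrite -(eqn_pmul2l (m := j.+1)) //; apply/eqP.
  have -> : (j.+1 * ((j + x).+2 * ((u1 + u2) * (j + x).+3)) =
      j.+1 * (j + x).+2 * (u1 * (j + x).+3) +
      j.+1 * (j + x).+3 * (u2 * (j + x).+2))%N by ring.
  rewrite H1 H2; move: B1; clear; nia.
Qed.

(** From [j] to [j+1] the left side grows by the factor 4(2j+1)(2j+3)/(j+1)^2, which is at most 16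
    because (2j+1)(2j+3) <= 4(j+1)^2. *)
Lemma central_bin_bound j : ('C(j.*2, j) ^ 2 * j.*2.+1 <= 16 ^ j)%N.
Proof.
elim: j => [//|j IH].
have B1 := mul_bin_left j.*2.+1 j.
have B2 : ('C(j.*2.+2, j.+1) = 'C(j.*2.+1, j.+1) + 'C(j.*2.+1, j))%N by rewrite binS.
have B3 := mul_bin_down j.*2.+1 j.
have e : (j.*2.+1 - j = j.+1)%N by lia.
rewrite e /= in B1 B3.
rewrite doubleS B2.
have e1 : 'C(j.*2.+1, j.+1) = 'C(j.*2.+1, j).
  by apply/eqP; rewrite -(eqn_pmul2l (m := j.+1)) // B1.
rewrite e1 (expnS 16).
move: IH B3; clear; move: ('C(_, _)) ('C(_, _)) => v u IH B3.
rewrite -(leq_pmul2l (m := j.+1 ^ 2)) // .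
apply: (@leq_trans (16 * j.+1 ^ 2 * (u ^ 2 * j.*2.+1)));
  last by rewrite (mulnC 16%N) -mulnA !leq_pmul2l.
have -> : (j.+1 ^ 2 * ((v + v) ^ 2 * j.+1.*2.+1) = 4 * (j.+1 * v) ^ 2 * j.*2.+3)%N.
  by rewrite doubleS; ring.
rewrite -B3.
have -> : (4 * (j.*2.+1 * u) ^ 2 * j.*2.+3 =
    4 * (j.*2.+1 * j.*2.+3) * (u ^ 2 * j.*2.+1))%N by ring.
rewrite leq_mul2r; apply/orP; right; nia.
Qed.

(** Squaring turns the decay of order 3/2 into an inequality between naturals. For m = 2j the count
    is a Catalan number, and the 4 comes from 2j+1 <= 2(j+1). *)
Lemma ballot0_bound m : (ballot m 0 ^ 2 * m.+1 ^ 3 <= 4 * 4 ^ m)%N.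
Proof.
have [h|h] := boolP (odd m).
  by rewrite ballot_odd ?addn0.
have -> : m = (m./2).*2 by lia.
move: (m./2) => j.
have H1 := ballot_bin j 0; have H2 := central_bin_bound j.
rewrite !addn0 mul1n in H1; rewrite -H1 in H2.
have -> : (4 ^ j.*2 = 16 ^ j)%N by rewrite -muln2 mulnC expnM.
apply: leq_trans (leq_mul (leqnn 4) H2).
move: (ballot _ _) => u.
have -> : (u ^ 2 * j.*2.+1 ^ 3 = u ^ 2 * j.*2.+1 * j.*2.+1 ^ 2)%N by ring.
have -> : (4 * ((u * j.+1) ^ 2 * j.*2.+1) = u ^ 2 * j.*2.+1 * (4 * j.+1 ^ 2))%N by ring.
rewrite leq_mul2l; apply/orP; right; nia.
Qed.

(** * Sums over words and inverse moments of letter counts *)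

Lemma sum_tuple_cons (R : nmodType) (T : finType) n (F : seq T -> R) :
  \sum_(w : n.+1.-tuple T) F w = \sum_(s : T) \sum_(w : n.-tuple T) F (s :: w).
Proof.
rewrite pair_bigA /= (reindex (fun p : T * n.-tuple T => [tuple of p.1 :: p.2])) //.
exists (fun w => (thead w, [tuple of behead w])) => [[s w] _|w _] /=.
  by congr pair; apply: val_inj.
by rewrite [RHS]tuple_eta; apply: val_inj.
Qed.

Lemma sum_tuple0 (R : nmodType) (T : finType) (F : seq T -> R) :
  \sum_(w : 0.-tuple T) F w = F [::].
Proof.
rewrite (bigD1 [tuple]) //= big1 ?addr0 // => w /eqP [].
exact: tuple0.
Qed.

Section InverseMoments.
Variables (R : realFieldType) (T : finType) (P : pred T).

Lemma sum_count_cons n (F : nat -> R) :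
  \sum_(w : n.+1.-tuple T) F (count P w) =
  #|P|%:R * \sum_(w : n.-tuple T) F (count P w).+1 +
  #|[predC P]|%:R * \sum_(w : n.-tuple T) F (count P w).
Proof.
rewrite (sum_tuple_cons n (fun w => F (count P w))) (bigID P) /=.
congr (_ + _).
  transitivity (\sum_(s | P s) \sum_(w : n.-tuple T) F (count P w).+1).
    by apply: eq_bigr => s Ps; apply: eq_bigr => w _; rewrite Ps.
  by rewrite sumr_const mulr_natl.
transitivity (\sum_(s | ~~ P s) \sum_(w : n.-tuple T) F (count P w)).
  by apply: eq_bigr => s /negbTE Ps; apply: eq_bigr => w _; rewrite Ps.
by rewrite sumr_const mulr_natl.
Qed.

(* Size biasing: pick one of the [count P w] letters of [w] lying in [P] and delete it. *)
Lemma sum_size_biased n (G : nat -> R) :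
  \sum_(w : n.+1.-tuple T) (count P w)%:R * G (count P w) =
  n.+1%:R * #|P|%:R * \sum_(w : n.-tuple T) G (count P w).+1.
Proof.
elim: n G => [|n IH] G.
  rewrite (sum_count_cons _ (fun m => m%:R * G m)).
  rewrite (@sum_tuple0 _ T (fun w => (count P w).+1%:R * G (count P w).+1)).
  rewrite (@sum_tuple0 _ T (fun w => (count P w)%:R * G (count P w))).
  rewrite (@sum_tuple0 _ T (fun w => G (count P w).+1)) /=.
  by rewrite !mul0r mulr0 addr0 !mul1r.
rewrite (sum_count_cons _ (fun m => m%:R * G m)) IH.
under eq_bigr do rewrite -natr1 mulrDl mul1r.
rewrite big_split /= (IH (fun m => G m.+1)) (sum_count_cons _ (fun m => G m.+1)).
rewrite -[n.+2%:R]natr1; ring.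
Qed.

(** Induction on [r]: size biasing expresses the moment of order r+1 at length n through one of
    order r at length n+1, gaining the factor 1/((n+1)|P|). *)
Lemma inverse_moment_bound r : (0 < #|P|)%N -> exists2 K : R, 0 <= K &
  forall n, \sum_(w : n.-tuple T) ((count P w).+1%:R ^+ r)^-1 <=
            K * #|T|%:R ^+ n / n.+1%:R ^+ r.
Proof.
move=> P_gt0; elim: r => [|r [K K0 IH]].
  exists 1 => // n; under eq_bigr do rewrite expr0 invr1.
  by rewrite sumr_const card_tuple mul1r expr0 invr1 mulr1 natrX.
have a0 : 0 < #|P|%:R :> R by rewrite ltr0n.
exists (2 ^+ r * K * #|T|%:R / #|P|%:R) => [|n].
  by rewrite divr_ge0 ?mulr_ge0 ?exprn_ge0.
have na0 : 0 < n.+1%:R * #|P|%:R :> R by rewrite mulr_gt0.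
rewrite -(ler_pM2l na0) -(sum_size_biased _ (fun m => (m%:R ^+ r.+1)^-1)).
apply: (@le_trans _ _ (2 ^+ r * \sum_(w : n.+1.-tuple T) ((count P w).+1%:R ^+ r)^-1)).
  rewrite mulr_sumr; apply: ler_sum => w _.
  case: (count P w) => [|c].
    by rewrite mul0r mulr_ge0 ?exprn_ge0 ?invr_ge0 ?exprn_ge0.
  (* The factor 2^r pays for shifting the denominator: 1/(c+1) <= 2/(c+2). *)
  rewrite exprS invfM mulrA divff ?pnatr_eq0 // mul1r -!exprVn -exprMn.
  rewrite lerXn2r ?nnegrE ?mulr_ge0 ?invr_ge0 //.
  by rewrite ler_pdivlMr // mulrC ler_pdivrMr // -natrM ler_nat; lia.
apply: le_trans (ler_wpM2l (exprn_ge0 _ (ler0n _ 2)) (IH _)) _.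
have -> : n.+1%:R * #|P|%:R *
    (2 ^+ r * K * #|T|%:R / #|P|%:R * #|T|%:R ^+ n / n.+1%:R ^+ r.+1) =
  2 ^+ r * (K * #|T|%:R ^+ n.+1 / n.+1%:R ^+ r) :> R.
  have : n.+1%:R != 0 :> R by rewrite pnatr_eq0.
  have : #|P|%:R != 0 :> R by rewrite gt_eqF.
  move: (n.+1%:R) #|P|%:R => u v u0 v0; rewrite !exprS; field.
  by rewrite u0 v0 expf_neq0.
rewrite ler_wpM2l ?exprn_ge0 // ler_wpM2l ?mulr_ge0 ?exprn_ge0 //.
by rewrite lef_pV2 ?posrE ?exprn_gt0 // lerXn2r ?nnegrE // ler_nat.
Qed.

End InverseMoments.

(** * Reflection symmetry decouples the coordinates *)

Section Decoupling.
Variables (R : realFieldType) (d : nat) (S : {fset 'rV[int]_d}).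

(* The probability that [m] fair steps [+1] or [-1] lead from [x] to [0] without
   becoming negative. *)
Definition ballot_prob (m : nat) (x : int) : R :=
  if x is Posz y then (ballot m y)%:R / 2 ^+ m else 0.

(** First-step analysis with a fair sign. A zero entry leaves the coordinate in place and uses up no
    step; at x = 0 the downward move lands on a negative integer, where [ballot_prob] is 0. *)
Lemma ballot_prob_step m (x s : int) : 0 <= x -> s \in [:: -1; 0; 1] ->
  (ballot_prob m (x + s) + ballot_prob m (x - s)) / 2 =
  ballot_prob ((s != 0) + m) x.
Proof.
have half (u : R) : (u + u) / 2 = u by lra.
case: x => // x _; rewrite !inE => /or3P[] /eqP ->.
- rewrite opprK [_ != _]/= add1n; case: x => [|x].
    have [-> ->] : Posz 0 - 1 = Negz 0 /\ Posz 0 + 1 = 1%N by lia.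
    by rewrite /= exprS; field; rewrite expf_neq0.
  have -> : Posz x.+1 - 1 = x by lia.
  have -> : Posz x.+1 + 1 = x.+2 by lia.
  by rewrite /= natrD exprS; field; rewrite expf_neq0.
- by rewrite eqxx oppr0 addr0 half add0n.
- rewrite [_ != _]/= add1n; case: x => [|x].
    have [-> ->] : Posz 0 - 1 = Negz 0 /\ Posz 0 + 1 = 1%N by lia.
    by rewrite /= exprS; field; rewrite expf_neq0.
  have -> : Posz x.+1 - 1 = x by lia.
  have -> : Posz x.+1 + 1 = x.+2 by lia.
  by rewrite /= natrD exprS; field; rewrite expf_neq0.
Qed.

Hypothesis S_unit : unit_steps S.
Hypothesis S_sym : axis_symmetric S.

Lemma reflect_axisK (k : 'I_d) : involutive (@reflect_axis d k).
Proof.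
move=> s; apply/rowP => i; rewrite !mxE; case: eqP => // _.
by rewrite opprK.
Qed.

Lemma sum_reflect_axis (k : 'I_d) (F : 'rV[int]_d -> R) :
  \sum_(s : S) F (val s) = \sum_(s : S) F (reflect_axis k (val s)).
Proof.
pose h (s : S) : S := [` S_sym (valP s) k]%fset.
have hK : involutive h by move=> s; apply: val_inj; exact: reflect_axisK.
by rewrite (reindex_inj (inv_inj hK)).
Qed.

(** The axes are averaged one at a time; [r] lists those already treated. *)
Lemma sum_prod_symmetrize (g : 'I_d -> int -> R) :
  \sum_(s : S) \prod_k g k (val s 0 k) =
  \sum_(s : S) \prod_k ((g k (val s 0 k) + g k (- val s 0 k)) / 2).
Proof.
pose h (r : seq 'I_d) k (z : int) :=
  if k \in r then (g k z + g k (- z)) / 2 else g k z.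
suff H (r : seq 'I_d) : uniq r ->
    \sum_(s : S) \prod_k g k (val s 0 k) = \sum_(s : S) \prod_k h r k (val s 0 k).
  rewrite (H (enum 'I_d)) ?enum_uniq //; apply: eq_bigr => s _.
  by apply: eq_bigr => k _; rewrite /h mem_enum.
elim: r => [//|k r IH] /= /andP[kr /IH ->].
have half (u : R) : u = (u + u) / 2 by lra.
(* One half of the sum is reflected in axis [k], which alters only the [k]-th factor of each
   product. *)
rewrite [LHS]half {1}(sum_reflect_axis k (fun s => \prod_k h r k (s 0 k))).
rewrite -big_split /= mulr_suml; apply: eq_bigr => s _.
rewrite (bigD1 k) //= [X in _ + X](bigD1 k) //= [RHS](bigD1 k) //=.
rewrite {1 3 5}/h mxE eqxx (negbTE kr) inE eqxx /=.
have -> : \prod_(i < d | i != k) h r i (reflect_axis k (val s) 0 i) =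
          \prod_(i < d | i != k) h r i (val s 0 i).
  by apply: eq_bigr => i /negbTE ik; rewrite mxE ik.
have -> : \prod_(i < d | i != k) h (k :: r) i (val s 0 i) =
          \prod_(i < d | i != k) h r i (val s 0 i).
  by apply: eq_bigr => i /negbTE ik; rewrite /h inE ik.
ring.
Qed.

Definition active_steps (k : 'I_d) : pred S := fun s => val s 0 k != 0.

(** The free starting point allows an induction that removes the first step. *)
Definition excursion_from (x : 'rV[int]_d) (w : seq S) : bool :=
  all (fun m => in_orthant (x + walk_pos w m)) (iota 0 (size w).+1) &&
  (x + walk_pos w (size w) == 0).

Lemma walk_pos_cons (s : S) (w : seq S) m :
  walk_pos (s :: w) m.+1 = val s + walk_pos w m.
Proof. by rewrite /walk_pos /= big_cons. Qed.

Lemma excursion_from_cons x s w :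
  excursion_from x (s :: w) = in_orthant x && excursion_from (x + val s) w.
Proof.
rewrite /excursion_from walk_pos_cons addrA andbA; congr (_ && _).
have -> : iota 0 (size (s :: w)).+1 = [:: 0%N] ++ map (addn 1) (iota 0 (size w).+1).
  by rewrite -iotaDl addn0.
rewrite all_cat all_seq1 all_map {1}/walk_pos take0 big_nil addr0.
congr (_ && _); apply: eq_all => m /=.
by rewrite add1n walk_pos_cons addrA.
Qed.

Lemma num_excursionsE n :
  num_excursions S n = (\sum_(w : n.-tuple S) excursion_from 0 w)%N.
Proof.
rewrite /num_excursions cardE -sum1_size big_enum /= big_mkcond /=.
apply: eq_bigr => w _; rewrite inE /excursion_from size_tuple add0r.
congr nat_of_bool; congr (_ && _).
apply/forallP/allP => [H m|H m].
  by rewrite mem_iota add0n => /= mn; rewrite add0r; exact: (H (Ordinal mn)).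
by have := H m; rewrite mem_iota add0r; apply => /=.
Qed.

(** Remove the first step [s], apply the induction hypothesis at [x + s], symmetrize over [s], and
    recombine each factor by [ballot_prob_step]. *)
Lemma sum_excursion_from n x :
  \sum_(w : n.-tuple S) (excursion_from x w)%:R =
  \sum_(w : n.-tuple S) \prod_k ballot_prob (count (active_steps k) w) (x 0 k).
Proof.
have notin m (w : m.-tuple S) y : ~~ in_orthant y ->
    \prod_k ballot_prob (count (active_steps k) w) (y 0 k) = 0.
  rewrite negb_forall => /existsP[k]; rewrite (bigD1 k) //=.
  by case: (y 0 k) => //= z _; rewrite mul0r.
elim: n x => [|n IH] x.
  rewrite (@sum_tuple0 _ S (fun w => (excursion_from x w)%:R)).
  rewrite (@sum_tuple0 _ S (fun w =>
    \prod_k ballot_prob (count (active_steps k) w) (x 0 k))).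
  rewrite /excursion_from /= /walk_pos big_nil addr0 andbT.
  have [->|x0] := eqVneq x 0.
    rewrite andbT big1 => [|k _]; last by rewrite mxE /= divr1.
    by have -> : in_orthant (0 : 'rV[int]_d) by apply/forallP => k; rewrite mxE.
  rewrite andbF; have [k xk] : exists k, x 0 k != 0.
    apply/existsP; apply: contraNT x0; rewrite negb_exists => /forallP x0.
    by apply/eqP/rowP => k; apply/eqP; rewrite mxE; have := x0 k; rewrite negbK.
  rewrite (bigD1 k) //=; case: (x 0 k) xk => [[|z]|z] //= _; by rewrite !mul0r.
have [x_in|x_out] := boolP (in_orthant x); last first.
  rewrite (@sum_tuple_cons _ S n (fun w => (excursion_from x w)%:R)).
  rewrite [RHS]big1 => [|w _]; last exact: notin.
  rewrite big1 // => s _; rewrite big1 // => w _.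
  by rewrite excursion_from_cons (negbTE x_out).
rewrite (@sum_tuple_cons _ S n (fun w => (excursion_from x w)%:R)).
rewrite (@sum_tuple_cons _ S n (fun w =>
  \prod_k ballot_prob (count (active_steps k) w) (x 0 k))).
transitivity (\sum_(s : S) \sum_(w : n.-tuple S)
    \prod_k ballot_prob (count (active_steps k) w) (x 0 k + val s 0 k)).
  apply: eq_bigr => s _.
  transitivity (\sum_(w : n.-tuple S) (excursion_from (x + val s) w)%:R : R).
    by apply: eq_bigr => w _; rewrite excursion_from_cons x_in.
  by rewrite IH; apply: eq_bigr => w _; apply: eq_bigr => k _; rewrite mxE.
(* With the remaining word fixed, the sum over the first step is a sum of products over coordinates,
   ready for symmetrization. *)
rewrite exchange_big [RHS]exchange_big /=; apply: eq_bigr => w _.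
rewrite (sum_prod_symmetrize (fun k z =>
  ballot_prob (count (active_steps k) w) (x 0 k + z))).
apply: eq_bigr => s _; apply: eq_bigr => k _.
rewrite ballot_prob_step //; first by move/forallP: x_in.
by have [_] := S_unit (valP s).
Qed.

End Decoupling.

(** * The asymptotic estimate *)

Lemma ballot_prob0_bound (R : realFieldType) m :
  ballot_prob R m 0 ^+ 2 <= 4 / m.+1%:R ^+ 3.
Proof.
rewrite /ballot_prob ler_pdivlMr ?exprn_gt0 // expr_div_n mulrAC.
rewrite ler_pdivrMr ?exprn_gt0 // -exprM mulnC exprM -!natrX -!natrM ler_nat.
exact: ballot0_bound.
Qed.

Lemma ballot_prob_ge0 (R : realFieldType) m x : 0 <= ballot_prob R m x.
Proof. by case: x => //= y; rewrite divr_ge0 ?exprn_ge0. Qed.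

(** The product is at most the [d]-th power of the largest factor, and that power is one of the
    summands. *)
Lemma prod_le_sum_expn (R : realFieldType) d (x : 'I_d -> R) :
  (0 < d)%N -> (forall k, 0 <= x k) -> \prod_k x k <= \sum_k x k ^+ d.
Proof.
case: d x => // d x _ x_ge0.
case: (@Order.TotalTheory.arg_maxP _ _ _ ord0 predT x isT) => k _ x_max.
apply: (@le_trans _ _ (x k ^+ d.+1)).
  rewrite -[X in _ ^+ X]card_ord -prodr_const; apply: ler_prod => i _.
  by rewrite x_ge0; exact: x_max.
by rewrite (bigD1 k) //= lerDl sumr_ge0 // => i _; rewrite exprn_ge0.
Qed.

(* The arithmetic-geometric mean inequality [y <= (t y^2 + 1/t) / 2], applied word
   by word with [t = n^(3d/2)], replaces the half-integer moments of the letter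
   counts by integer ones. *)
Lemma num_excursions_bound (R : realType) d (S : {fset 'rV[int]_d}) :
  (0 < d)%N ->
  unit_steps S -> axis_symmetric S -> forward_in_each_coordinate S ->
  exists2 K : R, 0 <= K & forall n, (0 < n)%N ->
    (num_excursions S n)%:R <= K * (#|` S|%:R ^+ n / n%:R `^ ((3 * d)%:R / 2)).
Proof.
move=> d_gt0 S_unit S_sym S_fwd.
have P_gt0 k : (0 < #|active_steps (S := S) k|)%N.
  have [s sS sk] := S_fwd k.
  by apply/card_gt0P; exists [` sS]%fset; rewrite unfold_in /active_steps /= sk.
(* The order 3d arises from the cubes in the squared ballot bound, raised to the power [d] by
   [prod_le_sum_expn]. *)
have [K K_ge0 HK] : exists2 K : 'I_d -> R, forall k, 0 <= K k &
    forall k n, \sum_(w : n.-tuple S)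
      ((count (active_steps k) w).+1%:R ^+ (3 * d))^-1 <=
      K k * #|{: S}|%:R ^+ n / n.+1%:R ^+ (3 * d).
  pose H k := cid2 (inverse_moment_bound R (3 * d) (P_gt0 k)).
  by exists (fun k => s2val (H k)) => k; case: (H k).
(* The first summand bounds the contribution of t y^2, the 1 that of 1/t summed over all |S|^n
   words; the half is that of the mean inequality. *)
exists ((4 ^+ d * \sum_k K k + 1) / 2) => [|n n_gt0].
  by rewrite divr_ge0 // addr_ge0 // mulr_ge0 ?exprn_ge0 // sumr_ge0.
set t := n%:R `^ _; have t_gt0 : 0 < t by rewrite powR_gt0 ?ltr0n.
have tt : t ^+ 2 = n%:R ^+ (3 * d).
  rewrite -powR_mulrn ?powR_ge0 // /t -powRrM -powR_mulrn //.
  by rewrite divfK.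
have -> : (num_excursions S n)%:R =
    \sum_(w : n.-tuple S) \prod_k ballot_prob R (count (active_steps k) w) 0.
  rewrite num_excursionsE natr_sum (sum_excursion_from R S_unit S_sym n 0).
  by apply: eq_bigr => w _; apply: eq_bigr => k _; rewrite mxE.
have amgm (y : R) : y <= (t * y ^+ 2 + t^-1) / 2.
  rewrite ler_pdivlMr // -subr_ge0.
  have -> : t * y ^+ 2 + t^-1 - y * 2 = t^-1 * (t * y - 1) ^+ 2.
    by field; rewrite gt_eqF.
  by rewrite mulr_ge0 ?sqr_ge0 // invr_ge0 ltW.
have sq_bound (w : n.-tuple S) :
    (\prod_k ballot_prob R (count (active_steps k) w) 0) ^+ 2 <=
    4 ^+ d * \sum_k ((count (active_steps k) w).+1%:R ^+ (3 * d))^-1.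
  rewrite -prodrXl.
  apply: (@le_trans _ _ (\prod_(k < d) (4 / (count (active_steps k) w).+1%:R ^+ 3))).
    by apply: ler_prod => k _; rewrite sqr_ge0 ballot_prob0_bound.
  rewrite big_split /= prodr_const card_ord ler_wpM2l ?exprn_ge0 //.
  apply: le_trans (prod_le_sum_expn d_gt0 _) _.
    by move=> k; rewrite invr_ge0 exprn_ge0.
  by apply: ler_sum => k _; rewrite exprVn -exprM.
apply: (@le_trans _ _ (\sum_(w : n.-tuple S)
  (t * (4 ^+ d * \sum_k ((count (active_steps k) w).+1%:R ^+ (3 * d))^-1) + t^-1) / 2)).
  apply: ler_sum => w _; apply: le_trans (amgm _) _.
  by rewrite ler_pM2r ?invr_gt0 // lerD2r ler_pM2l.
rewrite -mulr_suml big_split /= -!mulr_sumr sumr_const card_tuple exchange_big /=.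
rewrite mulrAC ler_pM2r ?invr_gt0 // mulrDl mul1r cardfE -[t^-1 *+ _]mulr_natl natrX.
rewrite lerD2r.
(* Since t^2 = n^(3d), the product of t with the moments of order n^(-3d) has order 1/t. *)
have -> : 4 ^+ d * (\sum_k K k) * (#|{: S}|%:R ^+ n / t) =
          t * (4 ^+ d * \sum_k (K k * #|{: S}|%:R ^+ n / n%:R ^+ (3 * d))) :> R.
  by rewrite -!mulr_suml -tt; field; rewrite gt_eqF.
rewrite ler_pM2l // ler_wpM2l ?exprn_ge0 //; apply: ler_sum => k _.
apply: le_trans (HK k n) _; rewrite ler_wpM2l ?mulr_ge0 ?exprn_ge0 //.
by rewrite lef_pV2 ?posrE ?exprn_gt0 ?ltr0n // lerXn2r ?nnegrE // ler_nat.
Qed.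

Theorem theorem7p2 (R : realType) (d : nat) (S : {fset 'rV[int]_d}) :
  unit_steps S -> axis_symmetric S -> forward_in_each_coordinate S ->
  (fun n : nat => (num_excursions S n)%:R : R) =O_\oo
  (fun n : nat => #|` S|%:R ^+ n / n%:R `^ ((3 * d)%:R / 2) : R).
Proof.
move=> S_unit S_sym S_fwd.
have [K K_ge0 HK] : exists2 K : R, 0 <= K & forall n, (0 < n)%N ->
    (num_excursions S n)%:R <= K * (#|` S|%:R ^+ n / n%:R `^ ((3 * d)%:R / 2)).
  have [d0|d_gt0] := posnP d; last exact: num_excursions_bound.
  (* In dimension 0 the only vector is zero, so [S] is empty and there is no word of positive
     length. *)
  exists 0 => // n n_gt0; rewrite mul0r.
  suff -> : num_excursions S n = 0%N by [].
  apply/eqP; rewrite cards_eq0; apply/eqP/setP => w; rewrite !inE.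
  case: n n_gt0 w => // n _ w.
  have [/eqP[]] := S_unit _ (valP (thead w)).
  by apply/rowP => k; have := ltn_ord k; rewrite [X in (_ < X)%N]d0.
(* [K] may be 0, whereas the constant must be positive. *)
apply/eqO_exP; exists (K + 1); first by rewrite ltr_wpDl.
near=> n.
have n_gt0 : (0 < n)%N by near: n; exists 1%N.
have f_ge0 : 0 <= #|` S|%:R ^+ n / n%:R `^ ((3 * d)%:R / 2) :> R.
  by rewrite divr_ge0 ?exprn_ge0 ?powR_ge0.
rewrite !ger0_norm //; apply: le_trans (HK n n_gt0) _.
by rewrite ler_wpM2r // lerDl.
Unshelve. all: by end_near.
Qed.
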